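(* There exists a monotone class $\mathcal C$ consisting of triangle-free graphs with unbounded chromatic number and sublinear separators.
   Context: All graphs are finite, simple and nonempty. A graph class is monotone if it is closed under taking (not necessarily induced) subgraphs. It has unbounded chromatic number if $\sup_{G\in\mathcal C}\chi(G)=\infty$. A balanced separator of $G$ is a set $S\subseteq V(G)$ such that every connected component of $G-S$ has at most $2|V(G)|/3$ vertices. A class $\mathcal C$ has sublinear separators if there exists a function $f(n)=o(n)$ such that every $n$-vertex graph $G\in\mathcal C$ has a balanced separator of size at most $f(n)$. *)

(* Defs.v *)
From mathcomp Require Import all_boot all_order all_algebra.
From mathcomp Require Import all_classical all_reals all_analysis.

Set Implicit Arguments.
Unset Strict Implicit.
Unset Printing Implicit Defensive.

Import Order.TTheory GRing.Theory Num.Theory.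
Import numFieldNormedType.Exports.

Record sgraph := SGraph {
  vertex :> finType;
  edge : rel vertex;
  edge_sym : symmetric edge;
  edge_irrefl : irreflexive edge;
  vertex_nonempty : 0 < #|vertex| }.

Definition graph_class := sgraph -> Prop.

(* H is isomorphic to a (not necessarily induced) subgraph of G.  Vertex types
   are arbitrary, so classes have to be read up to isomorphism. *)
Definition subgraph (H G : sgraph) : Prop :=
  exists h : H -> G,
    injective h /\ forall x y : H, edge x y -> edge (h x) (h y).

Definition monotone_class (C : graph_class) : Prop :=
  forall G H : sgraph, C G -> subgraph H G -> C H.

Definition triangle_free (G : sgraph) : Prop :=
  ~ exists x y z : G, [/\ edge x y, edge y z & edge x z].

Definition colorable (G : sgraph) (k : nat) : bool :=
  [exists c : {ffun G -> 'I_k},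
     [forall x : G, forall y : G, edge x y ==> (c x != c y)]].

Lemma colorable_card (G : sgraph) : colorable G #|G|.
Proof.
apply/existsP; exists [ffun x => enum_rank x].
apply/forallP => x; apply/forallP => y; apply/implyP => exy.
rewrite !ffunE (inj_eq enum_rank_inj).
by apply: contraTneq exy => ->; rewrite edge_irrefl.
Qed.

Definition chromatic_number (G : sgraph) : nat :=
  ex_minn (ex_intro (fun k => colorable G k) #|G| (colorable_card G)).

Definition unbounded_chromatic_number (C : graph_class) : Prop :=
  forall k : nat, exists G : sgraph, C G /\ k < chromatic_number G.

Definition edge_minus (G : sgraph) (S : {set G}) : rel G :=
  [rel x y | [&& x \notin S, y \notin S & edge x y]].

(* Vertex sets of the connected components of G - S. *)
Definition components_minus (G : sgraph) (S : {set G}) : {set {set G}} :=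
  equivalence_partition (connect (edge_minus S)) (~: S).

Definition balanced_separator (G : sgraph) (S : {set G}) : Prop :=
  forall K : {set G}, K \in components_minus S -> 3 * #|K| <= 2 * #|G|.

Local Open Scope classical_set_scope.

Definition sublinear_separators (R : realType) (C : graph_class) : Prop :=
  exists f : nat -> R,
    (f =o_\oo (fun n : nat => n%:R : R))%R /\
    forall G : sgraph, C G ->
      exists S : {set G}, balanced_separator S /\ (#|S|%:R <= f #|G|)%R.

(* Main.v *)
Require Import Defs.
From mathcomp Require Import all_boot all_order all_algebra.
From mathcomp Require Import all_classical all_reals all_analysis.
(* Imported again, so that names shared with classical sets denote finite sets. *)
From mathcomp Require Import all_boot all_order all_algebra zify.

Set Implicit Arguments.
Unset Strict Implicit.
Unset Printing Implicit Defensive.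

(** The class consists of all subgraphs of the members of one sequence of
    graphs T 0, T 1, ... of Blanche Descartes type.  The graph T (k+1) has an
    independent set W of anchors and many disjoint copies of T k; every copy is
    matched with a block of a hypergraph on W in which each (k+1)-colouring of
    the points has a monochromatic block.  The copy over a monochromatic block
    has to avoid the colour of the block, so T (k+1) is not (k+1)-colourable,
    and no triangle arises.

    If all |T k|-subsets of W were blocks, T (k+1) would contain subdivisions
    of expanders.  So the hypergraph has to be chosen with care: call it
    M-sparse if every nonempty set X of incidences without pendant incidences
    can be split, by a 2-colouring of the blocks, into two nonempty halves such
    that the number of points that meet both halves is at most 1/M times the
    size of either half (sparse_cuts).  Each cycle is such an X, hence M-sparse
    hypergraphs have girth of order M; but M-sparseness also forbids large
    expanding sets of incidences.

    Monochromatic M-sparse hypergraphs exist for all M = 2^t and all block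
    sizes (sparse_monochromatic).  The case M = 1 is trivial: cut off the
    smaller one of two blocks that share a point.  The step from M to 2M is the
    partite construction of Nesetril and Rodl: copies of a partite hypergraph P
    are glued along one of their parts, as prescribed by an M-sparse hypergraph
    Q whose points form the glued part.  A set X of incidences of the result
    has a trace on Q.  If the trace has a cheap cut, then so has X, and the
    cost is halved because a block that meets the glued part does so in one
    point only and has a second incidence elsewhere.  If not, then the trace
    is a forest, so up to pendant pieces X lives in a single copy of P, and one
    can induct.  Only one level of the construction matters for any given X;
    therefore nothing is lost although the number of levels is unbounded.

    At the level of graphs the same dichotomy holds (cut_or_small_descartes).
    Fix t.  The steps from T k to T (k+1) with k at least t use 2^t-sparse
    hypergraphs, so a vertex set of any T k either has a cut of relative cost
    2^-t, or is a tree-like arrangement of pieces of the graphs T 0, ..., T t;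
    in the second case some F vertices, with F depending on t only, leave no
    component with more than half of the weight.  When cheap cuts are made as
    long as possible and the smaller side is put aside each time, the total cost
    is at most n / 2^t; this gives balanced separators of size at most
    n / 2^t + F.  As t is arbitrary, the best bound in terms of n is o(n). *)

(** * Hypergraphs with cheap cuts *)

(** The blocks are indexed by a fixed type S, so that a copy of a structure on S
    can be placed on each block; an incidence is a pair in block * S. *)
Record system (S : finType) := System {
  point : finType;
  block : finType;
  place : block -> S -> point;
  place_inj : forall e, injective (place e) }.

Section Cuts.
Variables (S : finType) (H : system S).
Implicit Types (X Y : {set block H * S}) (side : block H -> bool).

Definition foot (p : block H * S) : point H := place p.1 p.2.

Definition node := (point H + block H)%type.

Definition meets (p : block H * S) (n : node) : bool :=
  match n with inl w => foot p == w | inr e => p.1 == e end.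

Definition deg (X : {set block H * S}) (n : node) : nat :=
  #|[set p in X | meets p n]|.

Definition half (X : {set block H * S}) (side : block H -> bool) (b : bool) :=
  [set p in X | side p.1 == b].

Definition border (X : {set block H * S}) (side : block H -> bool) :=
  (foot @: half X side true) :&: (foot @: half X side false).

Definition cuttable (M : nat) (X : {set block H * S}) : Prop :=
  exists side : block H -> bool, forall b : bool,
    half X side b != set0 /\ M * #|border X side| <= #|half X side b|.

(** A node of degree 1 would carry a pendant incidence; such incidences cannot
    be cut off cheaply, but by cuttable_leaf they do no harm either. *)
Definition sparse_cuts (M : nat) : Prop :=
  forall X : {set block H * S},
    X != set0 -> (forall n, deg X n != 1) -> cuttable M X.

Lemma foot_borderP X side w :
  reflect (forall b, exists2 p, p \in X & (foot p = w) /\ (side p.1 = b))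
          (w \in border X side).
Proof.
apply: (iffP idP) => [|wP].
  rewrite inE => /andP[/imsetP[p]]; rewrite inE => /andP[pX /eqP ps] wp.
  case/imsetP=> q; rewrite inE => /andP[qX /eqP qs] wq.
  by case; [exists p | exists q].
rewrite inE; apply/andP; split.
  have [p pX [<- ps]] := wP true.
  by apply: imset_f; rewrite inE pX ps.
have [p pX [<- ps]] := wP false.
by apply: imset_f; rewrite inE pX ps.
Qed.

Lemma foot_inj p q : foot p = foot q -> p.1 = q.1 -> p = q.
Proof.
case: p q => [e s] [f t] /= + ef; rewrite /foot /= -ef => /place_inj ->.
by rewrite ef.
Qed.

Lemma cuttable_weaken M N X : M <= N -> cuttable N X -> cuttable M X.
Proof.
move=> MN [side sP]; exists side => b; have [n0 le] := sP b; split=> //.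
by apply: leq_trans le; rewrite leq_mul2r MN orbT.
Qed.

Lemma sparse_cuts_weaken M N : M <= N -> sparse_cuts N -> sparse_cuts M.
Proof. by move=> MN sN X X0 dX; apply: cuttable_weaken MN _; apply: sN. Qed.

Lemma cuttable_mono M X Y side side' :
  (forall b, half Y side b != set0 /\ M * #|border Y side| <= #|half Y side b|) ->
  (forall b, half Y side b \subset half X side' b) ->
  border X side' \subset border Y side ->
  cuttable M X.
Proof.
move=> sP hs bs; exists side' => b; have [n0 le] := sP b; split.
  by apply: contraNneq n0 => e0; rewrite -subset0 -e0 hs.
apply: leq_trans (leq_trans le (subset_leq_card (hs b))).
by rewrite leq_mul2l subset_leq_card ?orbT.
Qed.

Lemma deg1_unique X n p q :
  deg X n = 1 -> p \in X -> meets p n -> q \in X -> meets q n -> q = p.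
Proof.
move=> /eqP /cards1P[r rE] pX pn qX qn.
have: p \in [set p in X | meets p n] by rewrite inE pX.
have: q \in [set p in X | meets p n] by rewrite inE qX.
by rewrite rE !inE => /eqP -> /eqP ->.
Qed.

(** Pendant incidences never obstruct a cut: when the pendant end is a block, it
    can join the side of the point on which it hangs. *)
Lemma cuttable_leaf M X n p :
  p \in X -> meets p n -> deg X n = 1 -> cuttable M (X :\ p) -> cuttable M X.
Proof.
move=> pX pn d1 [side sP].
have uniq q : q \in X -> meets q n -> q = p by apply: deg1_unique d1 pX pn.
case: n pn d1 uniq => [w|e] /= /eqP pn d1 uniq.
  apply: (cuttable_mono (side' := side) sP).
    by move=> b; apply/subsetP => q; rewrite !inE -andbA => /andP[_].
  apply/subsetP => u /foot_borderP uP; apply/foot_borderP.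
  have [q qX [qu qs]] := uP true; have [r rX [ru rs]] := uP false.
  have neq : q <> r by move=> qr; rewrite qr rs in qs.
  have uw : u <> w.
    move=> uw; apply: neq.
    have -> : q = p by apply: uniq; rewrite //= qu uw.
    by have -> : r = p by apply: uniq; rewrite //= ru uw.
  have np z : foot z = u -> z != p.
    by move=> zu; apply/eqP => zp; apply: uw; rewrite -zu zp.
  by case; [exists q | exists r] => //; rewrite !inE np.
(* The block e has no incidence but p, so its side is free. *)
pose b0 := foot p \in foot @: half (X :\ p) side true.
pose side' f := if f == e then b0 else side f.
have other q : q \in X -> q != p -> side' q.1 = side q.1.
  move=> qX qp; rewrite /side'; case: eqP => // qe.
  by move: qp; rewrite (uniq q qX) ?qe ?eqxx.
have sp : side' p.1 = b0 by rewrite /side' pn eqxx.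
apply: (cuttable_mono (side' := side') sP).
  move=> b; apply/subsetP => q; rewrite !inE => /andP[/andP[qp qX] qs].
  by rewrite qX other.
apply/subsetP => u /foot_borderP uP; apply/foot_borderP.
have [q qX [qu qs]] := uP true; have [r rX [ru rs]] := uP false.
have [qp|qp] := eqVneq q p.
  have rp : r != p by apply/eqP => rp; rewrite qp -rp rs in qs.
  have : b0 by rewrite -sp -qp qs.
  move=> /imsetP[z]; rewrite !inE => /andP[/andP[zp zX] /eqP zs] pz.
  case.
    by exists z; rewrite ?inE ?zp // -pz -qp.
  by exists r; rewrite ?inE ?rp // -other.
have [rp|rp] := eqVneq r p.
  have : b0 by apply/imsetP; exists q; rewrite ?inE ?qp ?qX -?other ?qs // -rp ru qu.
  by rewrite -sp -rp rs.
by case; [exists q | exists r]; rewrite ?inE ?qp ?rp // -?other.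
Qed.

Lemma degD1_off X p n : ~~ meets p n -> deg (X :\ p) n = deg X n.
Proof.
move=> pn; rewrite /deg; apply: eq_card => q; rewrite !inE.
by case: eqP => //= ->; rewrite (negbTE pn) andbF.
Qed.

Lemma degD1_on X p n : p \in X -> meets p n -> deg X n = (deg (X :\ p) n).+1.
Proof.
move=> pX pn; rewrite /deg (cardsD1 p) !inE pX pn; congr (_.+1).
by apply: eq_card => q; rewrite !inE andbA.
Qed.

Lemma deg_gt0 X n p : p \in X -> meets p n -> 0 < deg X n.
Proof. by move=> pX pn; apply/card_gt0P; exists p; rewrite inE pX. Qed.

Lemma deg_gt0P X n : 0 < deg X n -> exists2 p, p \in X & meets p n.
Proof. by case/card_gt0P => p; rewrite inE => /andP[]; exists p. Qed.

(** A forest with an edge has at least two leaves: when pendant incidences are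
    removed one after another, the unique tip walks along a path, which ends in
    a nonempty set of incidences without any tip. *)
Lemma one_tip M : sparse_cuts M ->
  forall (X : {set block H * S}) (tip : node),
    X != set0 -> (forall n, n != tip -> deg X n != 1) -> cuttable M X.
Proof.
move=> sH X; have [k] := ubnP #|X|; elim: k X => // k IH X ltk tip X0 dX.
have [d1|d1] := eqVneq (deg X tip) 1; last first.
  by apply: sH => // n; have [->|/dX] := eqVneq n tip.
have [p pX ptip] : exists2 p, p \in X & meets p tip.
  by apply: deg_gt0P; rewrite d1.
apply: (cuttable_leaf pX ptip d1).
pose far : node := if tip is inl _ then inr p.1 else inl (foot p).
have pfar : meets p far by rewrite /far; case: (tip) => [w|e] /=.
have far_tip : far != tip by rewrite /far; case: (tip).
have dfar : 1 < deg X far.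
  by rewrite ltn_neqAle eq_sym dX // (deg_gt0 pX pfar).
have only n : meets p n -> (n == tip) || (n == far).
  rewrite /far; case: (tip) ptip => [w|e] /= /eqP pt; case: n => [w'|e'] /= /eqP pn.
  - by rewrite -pt -pn eqxx.
  - by rewrite -pn eqxx.
  - by rewrite -pn eqxx.
  - by rewrite -pt -pn eqxx.
apply: (IH _ _ far).
- by rewrite (cardsD1 p) pX in ltk.
- have : 0 < deg (X :\ p) far by rewrite (degD1_on pX pfar) in dfar.
  by case/deg_gt0P => q qX _; apply/set0Pn; exists q.
- move=> n nfar; have [pn|pn] := boolP (meets p n).
    have := only n pn; rewrite (negbTE nfar) orbF => /eqP ->.
    by move: d1; rewrite (degD1_on pX ptip) => -[->].
  rewrite degD1_off //; apply: dX; apply: contraNneq pn => ->; exact: ptip.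
Qed.

(** Without pendants some point lies on two blocks, and the smaller block has no
    more points than it has incidences. *)
Lemma sparse_cuts1 : sparse_cuts 1.
Proof.
move=> X /set0Pn[p pX] dX.
have [q qX [qp fqp]] : exists2 q, q \in X & q != p /\ foot q = foot p.
  have pn : meets p (inl (foot p)) by rewrite /=.
  have := dX (inl (foot p)); rewrite (degD1_on pX pn) eqSS -lt0n.
  case/deg_gt0P => q; rewrite !inE => /andP[qp qX] /= /eqP fq.
  by exists q.
have ne : q.1 != p.1 by apply: contra_neq qp; apply: foot_inj.
pose star (e : block H) := [set r in X | r.1 == e].
wlog le : p q pX qX qp fqp ne / #|star p.1| <= #|star q.1|.
  move=> W; case/orP: (leq_total #|star p.1| #|star q.1|) => le.
    by apply: (W p q).
  by apply: (W q p) => //; rewrite eq_sym.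
exists (eq_op^~ p.1).
have hT : half X (eq_op^~ p.1) true = star p.1.
  by apply/setP => r; rewrite !inE eqb_id.
have hF : star q.1 \subset half X (eq_op^~ p.1) false.
  apply/subsetP => r; rewrite !inE => /andP[-> /eqP ->] /=.
  by rewrite (negbTE ne).
have lb : #|border X (eq_op^~ p.1)| <= #|star p.1|.
  apply: leq_trans (subset_leq_card (subsetIl _ _)) _.
  by rewrite hT leq_imset_card.
case; rewrite mul1n; split.
- by apply/set0Pn; exists p; rewrite !inE pX eqxx.
- by rewrite hT.
- by apply/set0Pn; exists q; rewrite !inE qX (negbTE ne).
- by apply: leq_trans lb (leq_trans le (subset_leq_card hF)).
Qed.

End Cuts.

(** * Gluing copies of a partite hypergraph along a part *)

Section Amalgam.
Variables (S I : finType) (P : system S) (part : point P -> I) (i : I).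
Definition class_of : finType := {v : point P | part v == i}.
Variable Q : system class_of.

(** Copy f of P has its part i placed on the block f of Q; the remaining points
    of the copy are private.  The pairs (f, w) with w in part i are isolated
    points of the amalgam. *)
Definition glue (f : block Q) (w : point P) : (point Q + block Q * point P)%type :=
  if insub w is Some v then inl (place f v) else inr (f, w).

Lemma glue_in f (v : class_of) : glue f (val v) = inl (place f v).
Proof. by rewrite /glue valK. Qed.

Lemma glue_out f w : part w != i -> glue f w = inr (f, w).
Proof. by move=> pw; rewrite /glue insubN. Qed.

Lemma glueP f w : (exists2 v : class_of, w = val v & glue f w = inl (place f v)) \/
                  (part w != i /\ glue f w = inr (f, w)).
Proof.
have [pw|pw] := boolP (part w == i).
  by left; exists (Sub w pw); rewrite ?SubK // -glue_in SubK.
by right; rewrite glue_out.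
Qed.

Lemma glue_inj f : injective (glue f).
Proof.
move=> w w'; case: (glueP f w) => [[v -> ->]|[_ ->]];
  case: (glueP f w') => [[v' -> ->]|[_ ->]] //.
  by case=> /place_inj ->.
by case.
Qed.

Lemma glue_meet f f' w w' : glue f w = glue f' w' -> f != f' ->
  exists v v' : class_of, [/\ w = val v, w' = val v' & place f v = place f' v'].
Proof.
case: (glueP f w) => [[v -> ->]|[_ ->]];
  case: (glueP f' w') => [[v' -> ->]|[_ ->]] //.
  by case=> e _; exists v, v'.
by case=> ->; rewrite eqxx.
Qed.

Lemma amalgam_inj (x : block Q * block P) :
  injective (fun s => glue x.1 (place x.2 s)).
Proof. by move=> s t /glue_inj/place_inj. Qed.

Definition amalgam : system S := System amalgam_inj.

Definition amalgam_part (w : point amalgam) : I :=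
  match w with inl _ => i | inr x => part x.2 end.

Lemma amalgam_partE (x : block amalgam) s :
  amalgam_part (place x s) = part (place x.2 s).
Proof.
rewrite /=; case: (glueP x.1 (place x.2 s)) => [[v -> ->]|[_ ->]] //=.
by rewrite (eqP (valP v)).
Qed.

Hypothesis transversal : forall e, injective (fun s => part (place (s := P) e s)).

Implicit Type X : {set block amalgam * S}.

Definition slice X (f : block Q) : {set block P * S} :=
  [set p | ((f, p.1), p.2) \in X].

Definition pattern X : {set block Q * class_of} :=
  [set y | [exists p in X, (p.1.1 == y.1) && (place p.1.2 p.2 == val y.2)]].

Lemma patternP X (y : block Q * class_of) :
  reflect (exists2 p, p \in X & p.1.1 = y.1 /\ place p.1.2 p.2 = val y.2)
          (y \in pattern X).
Proof.
rewrite inE; apply: (iffP exists_inP) => -[p pX].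
  by case/andP => /eqP ? /eqP ?; exists p.
by case=> e1 e2; exists p => //; rewrite e1 e2 !eqxx.
Qed.

Lemma other_incidence X p : (forall n, deg X n != 1) -> p \in X ->
  exists2 s, (p.1, s) \in X & s != p.2.
Proof.
move=> dX pX; have pn : meets p (inr p.1) by rewrite /=.
have := dX (inr p.1); rewrite (degD1_on pX pn) eqSS -lt0n.
case/deg_gt0P => q; rewrite !inE => /andP[qp qX] /= /eqP q1; exists q.2.
  by rewrite -q1 -surjective_pairing.
by apply: contra_neq qp => q2; rewrite (surjective_pairing q) q1 q2 -surjective_pairing.
Qed.

(** Every copy goes to one side, so a point on both sides is a point of Q on the
    border of the pattern.  Transversality gives the factor 2: an incidence of
    X in part i accounts for one incidence of the pattern, and its block has
    another incidence, necessarily outside part i. *)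
Lemma cuttable_pattern M X : (forall n, deg X n != 1) ->
  cuttable M (pattern X) -> cuttable M.*2 X.
Proof.
move=> dX [side sP]; pose side' (x : block amalgam) := side x.1.
have big b : (#|half (pattern X) side b|).*2 <= #|half X side' b|.
  pose A := [set p in half X side' b | part (place p.1.2 p.2) == i].
  pose B := [set p in half X side' b | part (place p.1.2 p.2) != i].
  have AB : #|half X side' b| = #|A| + #|B|.
    rewrite -(cardsID [set p | part (place p.1.2 p.2) == i]); congr (_ + _);
      by apply: eq_card => p; rewrite !inE // andbC.
  have leA : #|half (pattern X) side b| <= #|A|.
    have AY (p : block amalgam * S) : p \in A -> part (place p.1.2 p.2) == i.
      by rewrite inE => /andP[].
    pose g (p : block amalgam * S) : option (block Q * class_of) :=
      omap (pair p.1.1) (insub (place p.1.2 p.2)).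
    rewrite -(card_imset (half (pattern X) side b) (@Some_inj _)).
    apply: leq_trans (leq_imset_card g A).
    apply/subset_leq_card/subsetP => _ /imsetP[y yY ->].
    move: yY; rewrite inE => /andP[/patternP[p pX [p1 p2]] ys].
    apply/imsetP; exists p.
      by rewrite !inE pX /side' p1 ys p2 (valP y.2).
    by rewrite /g p1 p2 valK /= -surjective_pairing.
  have leB : #|A| <= #|B|.
    have AX (p : block amalgam * S) : p \in A -> p \in X.
      by rewrite !inE => /andP[/andP[]].
    pose nxt p := (p.1, odflt p.2 [pick s | ((p.1, s) \in X) && (s != p.2)]).
    have nxtP p : p \in A -> nxt p \in X /\ (nxt p).2 != p.2.
      move=> /AX pX; rewrite /nxt; case: pickP => [s /andP[]|no] //=.
      by have [s sX sp] := other_incidence dX pX; have := no s; rewrite sX sp.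
    rewrite -(card_in_imset (f := nxt) (D := A)); last first.
      move=> p q pA qA /(congr1 fst) /= pq.
      move: pA qA; rewrite !inE => /andP[_ /eqP pi] /andP[_ /eqP qi].
      rewrite (surjective_pairing p) (surjective_pairing q) pq; congr pair.
      by apply: (@transversal q.1.2); rewrite qi -pi pq.
    apply/subset_leq_card/subsetP => _ /imsetP[p pA ->].
    have [nX n2] := nxtP p pA; move: pA; rewrite !inE => /andP[/andP[pX ps] pi].
    rewrite nX ps /=; apply: contraNneq n2 => ni; apply/eqP.
    by apply: (@transversal p.1.2); rewrite (eqP pi) -ni.
  by rewrite AB -addnn leq_add // (leq_trans leA).
have small : #|border X side'| <= #|border (pattern X) side|.
  pose inl' : point Q -> point amalgam := inl.
  rewrite -(card_imset (f := inl') (border (pattern X) side)); last by move=> ? ? [].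
  apply/subset_leq_card/subsetP => u /foot_borderP uP.
  have [p pX [pu ps]] := uP true; have [q qX [qu qs]] := uP false.
  have ne : p.1.1 != q.1.1 by apply: contraTneq ps => e; rewrite /side' e [side _]qs.
  have fpq : glue p.1.1 (place p.1.2 p.2) = glue q.1.1 (place q.1.2 q.2).
    by move: pu; rewrite -qu.
  have [v [v' [ev ev' pv]]] := glue_meet fpq ne.
  have uE : u = inl (place p.1.1 v) by rewrite -pu /foot /= ev glue_in.
  rewrite uE; apply: imset_f; apply/foot_borderP; case.
    by exists (p.1.1, v) => //; apply/patternP; exists p.
  by exists (q.1.1, v') => //; apply/patternP; exists q.
exists side' => b; have [n0 le] := sP b; split.
  by rewrite -card_gt0 (leq_trans _ (big b)) // double_gt0 card_gt0.
apply: leq_trans (big b); rewrite -doubleMl leq_double.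
by apply: leq_trans le; rewrite leq_mul2l small orbT.
Qed.

Definition lift_node f (n : node P) : node amalgam :=
  match n with inl w => inl (glue f w) | inr e => inr (f, e) end.

Definition lift_inc f (p : block P * S) : block amalgam * S := ((f, p.1), p.2).

Lemma lift_inc_inj f : injective (lift_inc f).
Proof. by move=> [? ?] [? ?] [-> ->]. Qed.

Lemma mem_slice X f p : (p \in slice X f) = (lift_inc f p \in X).
Proof. by rewrite inE. Qed.

Lemma lift_incE f (p : block amalgam * S) :
  p.1.1 = f -> p = lift_inc f (p.1.2, p.2).
Proof. by case: p => [[f' e] s] /= ->. Qed.

Lemma lift_meets f p n : meets (lift_inc f p) (lift_node f n) = meets p n.
Proof.
case: n => [w|e] /=; first by rewrite /foot /= (inj_eq (@glue_inj f)).
by rewrite xpair_eqE eqxx.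
Qed.

Lemma slice_deg X f n : deg (slice X f) n =
  #|[set p in X | meets p (lift_node f n) & p.1.1 == f]|.
Proof.
rewrite /deg -(card_imset _ (@lift_inc_inj f)); apply: eq_card => p.
rewrite !inE; apply/imsetP/and3P.
  by case=> q; rewrite !inE => /andP[qX qn] ->; rewrite lift_meets.
case=> pX pn /eqP pf; exists (p.1.2, p.2); last exact: lift_incE.
by rewrite inE mem_slice -(lift_meets f) -lift_incE ?pX.
Qed.

Lemma slice_deg_full X f n :
  (forall p, p \in X -> meets p (lift_node f n) -> p.1.1 = f) ->
  deg (slice X f) n = deg X (lift_node f n).
Proof.
move=> only; rewrite slice_deg; apply: eq_card => p; rewrite !inE.
by case: (boolP (p \in X)) => //= pX; case: (boolP (meets _ _)) => //= pn;
  rewrite only ?eqxx.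
Qed.

(** If copy f meets the other copies at no more than one point, a cut of the
    slice extends: everything else joins the side of that point. *)
Lemma cuttable_slice M X f (w0 : point P) :
  (forall p, p \in X -> p.1.1 != f -> forall q, q \in X -> q.1.1 = f ->
     foot p = foot q -> place q.1.2 q.2 = w0) ->
  cuttable M (slice X f) -> cuttable M X.
Proof.
move=> one [side sP].
pose b0 := w0 \in @foot _ P @: half (slice X f) side true.
pose side' (x : block amalgam) := if x.1 == f then side x.2 else b0.
have sl p : p \in X -> p.1.1 = f -> (p.1.2, p.2) \in slice X f.
  by move=> pX pf; rewrite mem_slice -lift_incE.
have big b : lift_inc f @: half (slice X f) side b \subset half X side' b.
  apply/subsetP => _ /imsetP[p + ->]; rewrite !inE => /andP[pX ps].
  by rewrite pX /side' /= eqxx.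
have same_off p q : p \in X -> q \in X -> foot p = foot q ->
    p.1.1 = f -> q.1.1 != f -> side' p.1 != side' q.1 ->
    foot p \in glue f @: border (slice X f) side.
  move=> pX qX pq pf qf; rewrite /side' pf eqxx (negbTE qf) => sb.
  have pw : place p.1.2 p.2 = w0 by apply: (one q).
  have pS : (p.1.2, p.2) \in slice X f by exact: sl.
  rewrite {1}/foot /= pf; apply: imset_f.
  apply/foot_borderP.
  have [bT|bF] := boolP b0.
    have /imsetP[r] : b0 by []. 
    rewrite inE => /andP[rX /eqP rs] rw.
    case; first by exists r; rewrite // -rw pw.
    by exists (p.1.2, p.2) => //=; split => //; move: sb; rewrite bT; case: (side _).
  have sT : side p.1.2 by move: sb; rewrite (negbTE bF); case: (side _).
  by case/negP: bF; apply/imsetP; exists (p.1.2, p.2); rewrite ?inE ?sT ?andbT -?mem_slice.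
have small : #|border X side'| <= #|border (slice X f) side|.
  apply: leq_trans (leq_imset_card (glue f) _).
  apply/subset_leq_card/subsetP => u /foot_borderP uP.
  have [p pX [pu ps]] := uP true; have [q qX [qu qs]] := uP false.
  have pq : foot p = foot q by rewrite pu.
  have [pf|pf] := eqVneq p.1.1 f; last first.
    have [qf|qf] := eqVneq q.1.1 f; last first.
      by move: ps qs; rewrite /side' (negbTE pf) (negbTE qf) => ->.
    by rewrite -qu; apply: same_off pf _ => //; rewrite ps qs.
  have [qf|qf] := eqVneq q.1.1 f; last first.
    by rewrite -pu; apply: same_off qf _ => //; rewrite ps qs.
  rewrite -pu {1}/foot /= pf; apply: imset_f; apply/foot_borderP; case.
    exists (p.1.2, p.2); first exact: sl.
    by split=> //=; move: ps; rewrite /side' pf eqxx.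
  exists (q.1.2, q.2); first exact: sl.
  split; last by move: qs; rewrite /side' qf eqxx.
  by apply: (@glue_inj f); move: pq; rewrite /foot /= pf qf.
exists side' => b; have [n0 le] := sP b; split.
  have /set0Pn[p pb] := n0; apply/set0Pn; exists (lift_inc f p).
  by apply: (subsetP (big b)); apply: imset_f.
apply: leq_trans (leq_mul (leqnn M) small) (leq_trans le _).
by rewrite -(card_imset _ (@lift_inc_inj f)) subset_leq_card.
Qed.

(** When the pattern has no cheap cut, restrict it to the points that are shared
    by two copies.  If none is left, X lies in one copy or is disconnected.
    Otherwise Q, being sparse, provides a copy with a single shared point; in
    this copy X has at most one node of degree 1, and one_tip applies. *)
Lemma amalgam_sparse_cuts M :
  sparse_cuts P M.*2 -> sparse_cuts Q M -> sparse_cuts amalgam M.*2.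
Proof.
move=> sP sQ X X0 dX.
have [|ncut] := EM (cuttable M (pattern X)); first exact: cuttable_pattern.
have pat p v : p \in X -> place p.1.2 p.2 = val v -> (p.1.1, v) \in pattern X.
  by move=> pX pv; apply/patternP; exists p.
pose shared (y : block Q * class_of) :=
  [exists z in pattern X, (foot z == foot y) && (z.1 != y.1)].
pose Y := [set y in pattern X | shared y].
have meet p q : p \in X -> q \in X -> p.1.1 != q.1.1 -> foot p = foot q ->
    exists v, place q.1.2 q.2 = val v /\ (q.1.1, v) \in Y.
  move=> pX qX ne pq.
  have [v' [v [ev' ev vv]]] := glue_meet (pq : glue p.1.1 _ = glue q.1.1 _) ne.
  exists v; split=> //; rewrite inE (pat q v qX ev).
  apply/exists_inP; exists (p.1.1, v'); first exact: pat.
  by apply/andP; split=> //; apply/eqP.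
have nY : ~ cuttable M Y.
  case=> side sY; apply: ncut; apply: (cuttable_mono (side' := side) sY).
    by move=> b; apply/subsetP => y; rewrite !inE => /andP[/andP[-> _] ->].
  apply/subsetP => u /foot_borderP uP.
  have [y yX [yu ys]] := uP true; have [z zX [zu zs]] := uP false.
  have ne : y.1 != z.1 by apply: contraTneq ys => ->; rewrite zs.
  apply/foot_borderP; case.
    exists y => //; rewrite inE yX; apply/exists_inP; exists z => //.
    by rewrite zu yu eqxx eq_sym.
  exists z => //; rewrite inE zX; apply/exists_inP; exists y => //.
  by rewrite zu yu eqxx.
have [Y0|Y0] := eqVneq Y set0.
  have [p pX] := set0Pn _ X0; pose f := p.1.1.
  have apart q r : q \in X -> r \in X -> foot q = foot r -> q.1.1 = r.1.1.
    move=> qX rX qr; apply/eqP; apply/negPn/negP => ne.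
    by have [v [_ +]] := meet q r qX rX ne qr; rewrite Y0 inE.
  have [/existsP[q /andP[qX qf]]|none] := boolP [exists q, (q \in X) && (q.1.1 != f)].
    pose side (x : block amalgam) := x.1 == f.
    have b0 : border X side = set0.
      apply/setP => u; rewrite [RHS]inE; apply/negP => /foot_borderP uP.
      have [r rX [ru rs]] := uP true; have [t tX [tu ts]] := uP false.
      by move: rs ts; rewrite /side (apart r t) ?ru // => ->.
    exists side => b; rewrite b0 cards0 muln0; split=> //; apply/set0Pn.
    by case: b; [exists p | exists q]; rewrite !inE /side ?pX ?qX ?eqxx ?(negbTE qf).
  have all_f q : q \in X -> q.1.1 = f.
    move=> qX; apply/eqP; apply: contraNT none => qf.
    by apply/existsP; exists q; rewrite qX.
  apply: (@cuttable_slice _ _ f (place p.1.2 p.2)).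
    by move=> q qX; rewrite all_f ?eqxx.
  apply: sP.
    apply/set0Pn; exists (p.1.2, p.2).
    by rewrite mem_slice -lift_incE // ?pX.
  by move=> n; rewrite slice_deg_full // => q /all_f.
have [n n1] : exists n, deg Y n = 1.
  apply: contra_notP nY => none; apply: sQ => // n.
  by apply/eqP => n1; apply: none; exists n.
have [y yY yn] : exists2 y, y \in Y & meets y n by apply: deg_gt0P; rewrite n1.
have [z [zY fz ne]] : exists z, [/\ z \in Y, foot z = foot y & z.1 != y.1].
  move: (yY); rewrite inE => /andP[yX /exists_inP[z zX /andP[/eqP zy ne]]].
  exists z; split=> //; rewrite inE zX; apply/exists_inP; exists y => //.
  by rewrite zy eqxx eq_sym.
case: n n1 yn => [w|f] n1 /= /eqP yn.
  have zy : z = y by apply: (deg1_unique n1 yY _ zY) => /=; rewrite ?fz yn.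
  by rewrite zy eqxx in ne.
have only v : (f, v) \in Y -> v = y.2.
  have yn' : meets y (inr f) by apply/eqP.
  by move=> vY; rewrite -(deg1_unique n1 yY yn' vY (eqxx f)).
have at_y q r : q \in X -> r \in X -> q.1.1 != f -> r.1.1 = f -> foot q = foot r ->
    place r.1.2 r.2 = val y.2.
  move=> qX rX qf rf qr; have [|v [-> vY]] := meet q r qX rX _ qr.
    by rewrite rf.
  by rewrite (only v) // -rf.
apply: (@cuttable_slice _ _ f (val y.2)).
  by move=> q qX qf r rX rf qr; apply: at_y qf rf qr.
apply: (one_tip sP (tip := inl (val y.2))).
  move: (yY); rewrite inE => /andP[/patternP[p pX [p1 _]] _].
  apply/set0Pn; exists (p.1.2, p.2); rewrite mem_slice -lift_incE //.
  by rewrite p1.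
move=> m my; case: (posnP (deg (slice X f) m)) => [-> //|].
case/deg_gt0P => p pX pm.
rewrite slice_deg_full // => q qX qm; apply/eqP; apply: contraNT my => qf.
case: m pm qm => [w|e] /= /eqP pm /eqP qm; last by rewrite qm eqxx in qf.
have pw := at_y q (lift_inc f p) qX _ qf erefl.
have fqp : foot q = foot (lift_inc f p) by exact: etrans qm (congr1 (glue f) (esym pm)).
by rewrite -pm -(pw _ fqp) ?eqxx // -mem_slice.
Qed.

End Amalgam.

(** * Sparse hypergraphs with monochromatic blocks *)

Definition monochromatic (S : finType) (q : nat) (H : system S) : Prop :=
  forall c : point H -> 'I_q.+1, exists e kappa, forall s, c (place e s) = kappa.

(** Pigeonhole: some colour occurs at least #|S| times. *)
Lemma mono_injection (S : finType) (q N : nat) (d : 'I_N -> 'I_q.+1) :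
  q.+1 * #|S| <= N ->
  exists2 f : {ffun S -> 'I_N}, injective f & exists kappa, forall s, d (f s) = kappa.
Proof.
move=> leN.
have [kappa le] : exists kappa, #|S| <= #|[set x | d x == kappa]|.
  apply/existsP; apply: contraLR leN; rewrite -ltnNge => /existsPn small.
  have -> : N = \sum_(kappa : 'I_q.+1) #|[set x | d x == kappa]|.
    rewrite -[LHS]card_ord -sum1_card (partition_big d predT) //=.
    by apply: eq_bigr => k _; rewrite -sum1_card; apply: eq_bigl => x; rewrite inE.
  have S0 : 0 < #|S| by apply: leq_ltn_trans (leq0n _) _; rewrite ltnNge; exact: (small ord0).
  apply: (@leq_ltn_trans (\sum_(kappa : 'I_q.+1) #|S|.-1)).
    by apply: leq_sum => k _; have := small k; lia.
  by rewrite sum_nat_const card_ord ltn_mul2l /= prednK.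
pose f s : 'I_N := enum_val (widen_ord le (enum_rank s)).
have fk s : d (f s) = kappa.
  by have := enum_valP (widen_ord le (enum_rank s)); rewrite inE => /eqP.
exists [ffun s => f s]; last by exists kappa => s; rewrite ffunE.
by move=> s t; rewrite !ffunE => /enum_val_inj/(congr1 val)/= /val_inj/enum_rank_inj.
Qed.

Lemma exists_monochromatic (S : finType) (q : nat) :
  exists H : system S, monochromatic q H.
Proof.
pose N := q.+1 * #|S|.
pose B : finType := {f : {ffun S -> 'I_N} | injectiveb f}.
have inj (e : B) : injective (val e) by exact/injectiveP/(valP e).
exists (System inj) => c; have [f /injectiveP fI [kappa fk]] := @mono_injection S q N c (leqnn _).
by exists (exist _ f fI), kappa.
Qed.

Section Partite.
Variables (S I : finType) (q M : nat).

(** The invariant of the partite construction after the parts in L have been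
    processed: somewhere inside each colouring sit blocks of all types sigma on
    which the colour of a point depends only on its part, as far as L reaches. *)
Definition aligned (L : seq I) (P : system S) (part : point P -> I) : Prop :=
  forall c : point P -> 'I_q.+1, exists d : I -> 'I_q.+1,
  forall sigma : S -> I, injective sigma ->
  exists2 e : block P, (forall s, part (place e s) = sigma s)
    & forall s, sigma s \in L -> c (place e s) = d (sigma s).

(** One part is added to L by gluing along it with a system Q: on a monochromatic
    block f of Q the part i has a single colour, and the colouring of copy f is
    aligned on the previous parts.  The system Q depends on the size of part i,
    which is why sparse systems are needed for all index types at once. *)
Lemma exists_aligned :
  (forall S' : finType, exists2 H : system S', monochromatic q H & sparse_cuts H M) ->
  forall L : seq I, exists (P : system S) (part : point P -> I),
    [/\ forall e, injective (fun s => part (place e s)),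
        aligned L part & sparse_cuts P M.*2].
Proof.
move=> exQ; elim=> [|i L [P [part [tr al sP]]]].
  pose B : finType := {f : {ffun S -> I} | injectiveb f}.
  pose pl (e : B) (s : S) : (B * S)%type := (e, s).
  have inj e : injective (pl e) by move=> s t [].
  exists (System inj), (fun x : B * S => val x.1 x.2); split.
  - by move=> e; apply/injectiveP/(valP e).
  - move=> c; exists (fun=> ord0) => sigma inj_sigma.
    have fI : injectiveb [ffun s => sigma s].
      by apply/injectiveP => s t; rewrite !ffunE => /inj_sigma.
    by exists (exist (fun f => is_true (injectiveb (fun_of_fin f))) _ fI : B) => // s; rewrite /= ffunE.
  move=> X /set0Pn[p pX] dX; case/eqP: (dX (inl (foot p))).
  rewrite /deg -(cards1 p); apply: eq_card => r; rewrite !inE.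
  case: r p {dX} pX => [e s] [f t] pX; rewrite /= /foot /=.
  apply/andP/eqP => [[_ /eqP] //|eq_p].
  by rewrite eq_p; case: eq_p => -> ->; rewrite pX eqxx.
have [Q mQ sQ] := exQ (class_of part i).
exists (amalgam Q), (amalgam_part (Q := Q)); split.
- move=> x s t; rewrite !amalgam_partE; exact: tr.
- move=> c; have [f [kappa fk]] := mQ (fun w => c (inl w)).
  have [d dP] := al (fun w => c (glue f w)).
  exists (fun j => if j == i then kappa else d j) => sigma inj_sigma.
  have [e es ed] := dP sigma inj_sigma.
  exists (f, e) => s; first by rewrite amalgam_partE /= es.
  rewrite inE /= -es; case: (glueP f (place e s)) => [[v -> ->]|[ne ge]].
    by rewrite (valP v).
  by rewrite (negbTE ne) /= es => /ed.
exact: amalgam_sparse_cuts.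
Qed.

End Partite.

(** With all parts aligned, d colours the parts, and a type sigma whose image is
    monochromatic for d gives a monochromatic block. *)
Theorem sparse_monochromatic (S : finType) (q t : nat) :
  exists2 H : system S, monochromatic q H & sparse_cuts H (2 ^ t).
Proof.
elim: t S => [|t IH] S.
  have [H mH] := exists_monochromatic S q; exists H => //.
  exact: sparse_cuts1.
pose N := q.+1 * #|S|.
have [P [part [_ al sP]]] := @exists_aligned S 'I_N q _ IH (enum 'I_N).
exists P; last by rewrite expnS mul2n.
move=> c; have [d dP] := al c.
have [f inj_f [kappa fk]] := @mono_injection S q N d (leqnn _).
have [e es ed] := dP f inj_f.
by exists e, kappa => s; rewrite ed ?mem_enum.
Qed.

(** * Weighted cuts of graphs *)

Section WeightedCuts.
Variable G : sgraph.
Implicit Types (R T Z : {set G}) (w : G -> nat) (h : G -> option bool).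

Definition weight R w := \sum_(x in R) w x.

(** A partial 2-colouring h stands for the cut whose two banks are the colour
    classes and whose gap, the set of cut vertices, is left uncoloured. *)
Definition bank R h (b : bool) := [set x in R | h x == Some b].
Definition gap R h := [set x in R | h x == None].

Definition separates R h :=
  forall x y b c, x \in R -> y \in R -> edge x y ->
    h x = Some b -> h y = Some c -> b = c.

Definition cheap_cut M R w := exists2 h, separates R h &
  forall b, bank R h b != set0 /\ M * #|gap R h| <= weight (bank R h b) w.

(** The labelling l certifies that the components of R - Z weigh at most half of
    R, without mention of components: it is constant on each of them. *)
Definition halved R w Z := exists2 l : G -> nat,
  forall x y, x \in R :\: Z -> y \in R :\: Z -> edge x y -> l x = l y
  & forall i, 2 * weight [set x in R :\: Z | l x == i] w <= weight R w.

(** The weights make room for induction: parts that hang on a single vertex are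
    folded onto it, see fold_weight. *)
Definition cut_or_small M F := forall R w, (forall x, 0 < w x) ->
  cheap_cut M R w \/ exists2 Z : {set G}, #|Z| <= F & halved R w Z.

Lemma weightS R T w : R \subset T -> weight R w <= weight T w.
Proof.
move=> /setIidPr RT; rewrite /weight [X in _ <= X](big_setID R) /= RT.
exact: leq_addr.
Qed.

Lemma weightD R T w : T \subset R -> weight R w = weight (R :\: T) w + weight T w.
Proof. by move=> /setIidPr TR; rewrite /weight (big_setID T) /= TR addnC. Qed.

Lemma weight1 x w : weight [set x] w = w x.
Proof. by rewrite /weight big_set1. Qed.

Lemma card_le_weight R w : (forall x, 0 < w x) -> #|R| <= weight R w.
Proof. by move=> w0; rewrite -sum1_card; apply: leq_sum. Qed.

Definition fold_weight T y w x := w x + (if x == y then weight T w else 0).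

Lemma weight_fold R T y w :
  weight R (fold_weight T y w) = weight R w + (if y \in R then weight T w else 0).
Proof.
rewrite /weight big_split /=; congr (_ + _).
rewrite -big_mkcondr /=; case: ifP => yR.
  rewrite (bigD1 y) ?yR ?eqxx //= big1 ?addn0 // => x.
  by case/andP => /andP[_ ->].
by rewrite big1 // => x /andP[xR /eqP xy]; rewrite -xy xR in yR.
Qed.

(** If T hangs on the vertex y, nothing is lost by folding T onto y: both a cheap
    cut and a halving set of the rest serve for R, provided, in the second case,
    that T itself is not too heavy. *)

Section Fold.
Variables (M : nat) (R T : {set G}) (y : G) (w : G -> nat).
Hypotheses (TR : T \subset R) (yR : y \in R :\: T).
Hypothesis only_y : forall x z, x \in T -> z \in R :\: T -> edge x z -> z = y.
Let w' := fold_weight T y w.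

Lemma weight_unfold : weight (R :\: T) w' = weight R w.
Proof. by rewrite weight_fold yR (weightD w TR). Qed.

Lemma cheap_cut_unfold : cheap_cut M (R :\: T) w' -> cheap_cut M R w.
Proof.
case=> h hs hP.
pose b0 := odflt true (h y).
pose h' x := if x \in T then Some b0 else h x.
have inD x : x \in R -> x \notin T -> x \in R :\: T by rewrite inE => -> ->.
have side_T x z b c : x \in T -> z \in R -> z \notin T -> edge x z ->
    h' x = Some b -> h' z = Some c -> b = c.
  move=> xT zR zT xz; rewrite /h' xT (negbTE zT) => -[<-].
  by rewrite (only_y xT (inD z zR zT) xz) /b0 => ->.
exists h'.
  move=> x z b c xR zR xz.
  have [xT|xT] := boolP (x \in T); have [zT|zT] := boolP (z \in T).
  - by rewrite /h' xT zT => -[<-] [].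
  - exact: side_T.
  - rewrite edge_sym in xz.
    by move=> hx hz; apply/esym; apply: (side_T z x).
  - rewrite /h' (negbTE xT) (negbTE zT); apply: hs; rewrite ?inD //.
have gapE : gap R h' = gap (R :\: T) h.
  apply/setP => x; rewrite !inE /h'; case: (x \in T); rewrite ?andbF //=.
move=> b; have [n0 le] := hP b.
have sub : bank (R :\: T) h b \subset bank R h' b.
  by apply/subsetP => x; rewrite !inE /h' => /andP[/andP[/negbTE -> ->]].
split; first by apply: contraNneq n0 => e; rewrite -subset0 -e sub.
rewrite gapE; apply: leq_trans le _; rewrite weight_fold.
case: ifP => [yb|_]; last by rewrite addn0 weightS.
rewrite (weightD (T := bank (R :\: T) h b) _ sub) addnC leq_add2r.
apply/weightS/subsetP => x xT; rewrite !inE xT /= (subsetP TR _ xT) /h' xT /b0.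
by move: yb; rewrite inE => /andP[_ /eqP ->] /=.
Qed.

Lemma halved_unfold Z : 2 * weight T w <= weight R w ->
  halved (R :\: T) w' Z -> halved R w Z.
Proof.
move=> leT [l le lP].
pose l0 := if y \in Z then 0 else (l y).+1.
exists (fun x => if x \in T then l0 else (l x).+1).
  have T_out x z : x \in T -> z \in R :\: Z -> z \notin T -> edge x z -> l0 = (l z).+1.
    move=> xT; rewrite inE => /andP[zZ zR] zT xz.
    have zy : z = y by apply: (only_y xT) xz; rewrite inE zT.
    by rewrite /l0 -zy (negbTE zZ).
  move=> x z xR zR xz; case: ifPn => xT; case: ifPn => zT //.
  - exact: T_out xz.
  - by rewrite edge_sym in xz; apply/esym; apply: T_out xz.
  - congr _.+1; apply: le => //.
      by move: xR; rewrite !inE xT.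
    by move: zR; rewrite !inE zT.
case=> [|i].
  apply: leq_trans leT; rewrite leq_mul2l; apply/orP; right.
  by apply/weightS/subsetP => x; rewrite inE => /andP[_]; case: ifP.
set A := [set x in _ | _]; apply: leq_trans (_ : _ <= weight (R :\: T) w') _; last first.
  by rewrite weight_unfold.
apply: leq_trans (lP i); rewrite leq_mul2l; apply/orP; right.
rewrite weight_fold; set B := [set x in _ | l x == i].
have AB : A :\: T \subset B.
  apply/subsetP => x; rewrite !inE => /andP[xT /andP[/andP[xZ xR]]].
  by rewrite (negbTE xT) xR xZ.
have -> : weight A w = weight (A :\: T) w + weight (A :&: T) w.
  rewrite (weightD (T := A :&: T)) ?subsetIl //.
  by rewrite setDIr setDv set0U.
apply: leq_add; first exact: weightS.
have [->|/set0Pn[x xAT]] := eqVneq (A :&: T) set0; first by rewrite /weight big_set0.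
have -> : y \in B.
  move: xAT yR; rewrite !inE => /andP[/andP[_ +] xT]; rewrite xT /l0.
  by case: ifP => // yZ; rewrite eqSS => -> /andP[-> ->].
by rewrite weightS ?subsetIr.
Qed.

End Fold.
End WeightedCuts.

(** Cuts and halving sets of an induced subgraph G of G', transported along the
    embedding j. *)

Section Embedding.
Variables (G G' : sgraph) (j : G -> G').
Hypotheses (j_inj : injective j) (j_edge : forall x y, edge (j x) (j y) -> edge x y).
Variables (R : {set G}) (w : G' -> nat).

Lemma weight_embed (A : {set G}) : weight (j @: A) w = weight A (w \o j).
Proof. by rewrite /weight big_imset //= => x y _ _ /j_inj. Qed.

Definition pull (T : Type) (d : T) (f : G -> T) (x : G') : T :=
  if [pick v | j v == x] is Some v then f v else d.

Lemma pullE (T : Type) (d : T) f v : pull d f (j v) = f v.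
Proof.
rewrite /pull; case: pickP => [u /eqP/j_inj -> //|/(_ v)].
by rewrite eqxx.
Qed.

Lemma cheap_cut_embed M : cheap_cut M R (w \o j) -> cheap_cut M (j @: R) w.
Proof.
case=> h hs hP; exists (pull None h).
  move=> _ _ b c /imsetP[x xR ->] /imsetP[y yR ->] /j_edge xy.
  by rewrite !pullE; exact: hs.
have bankE b : bank (j @: R) (pull None h) b = j @: bank R h b.
  apply/setP => x; rewrite inE; apply/andP/imsetP => [[/imsetP[v vR ->]]|[v]].
    by rewrite pullE => vb; exists v; rewrite ?inE ?vR.
  by rewrite inE => /andP[vR vb] ->; rewrite pullE imset_f.
have gapE : gap (j @: R) (pull None h) = j @: gap R h.
  apply/setP => x; rewrite inE; apply/andP/imsetP => [[/imsetP[v vR ->]]|[v]].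
    by rewrite pullE => vb; exists v; rewrite ?inE ?vR.
  by rewrite inE => /andP[vR vb] ->; rewrite pullE imset_f.
move=> b; have [n0 le] := hP b; rewrite bankE gapE weight_embed card_imset //.
by split=> //; rewrite imset_eq0.
Qed.

Lemma halved_embed Z : halved R (w \o j) Z -> halved (j @: R) w (j @: Z).
Proof.
case=> l le lP.
have DE : j @: R :\: j @: Z = j @: (R :\: Z).
  apply/setP => x; rewrite inE; apply/andP/imsetP => [[xZ /imsetP[v vR xv]]|[v]].
    exists v => //; rewrite inE vR andbT; apply: contra xZ => vZ.
    by rewrite xv imset_f.
  by rewrite inE => /andP[vZ vR] ->; rewrite mem_imset // vZ imset_f.
exists (pull 0 l).
  move=> x y; rewrite DE => /imsetP[u uR ->] /imsetP[v vR ->] /j_edge uv.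
  by rewrite !pullE; apply: le.
move=> i; rewrite weight_embed; apply: leq_trans (lP i).
rewrite leq_mul2l /= -weight_embed; apply/weightS/subsetP => x; rewrite inE DE.
case/andP=> /imsetP[v vR ->]; rewrite pullE => vi; apply: imset_f.
by rewrite inE vR.
Qed.

End Embedding.

(** * Descartes graphs over a sparse hypergraph *)

Definition no_coloring (G : sgraph) (k : nat) : Prop :=
  ~ exists c : G -> 'I_k, forall x y : G, edge x y -> c x != c y.

Section Descartes.
Variables (G : sgraph) (H : system G) (e0 : block H).

(** A point of the hypergraph is an anchor.  An incidence (e, v) doubles as the
    vertex v of copy e, and its only anchor is its foot. *)
Definition dvertex : finType := (point H + block H * G)%type.

Definition dedge : rel dvertex := fun x y =>
  match x, y with
  | inl _, inl _ => false
  | inl u, inr p => foot p == u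
  | inr p, inl u => foot p == u
  | inr p, inr q => (p.1 == q.1) && edge p.2 q.2
  end.

Lemma dedge_sym : symmetric dedge.
Proof. by case=> [u|p] [v|q] //=; rewrite eq_sym edge_sym. Qed.

Lemma dedge_irrefl : irreflexive dedge.
Proof. by case=> [u|p] //=; rewrite edge_irrefl andbF. Qed.

Lemma dvertex_nonempty : 0 < #|dvertex|.
Proof.
have /card_gt0P[v _] := vertex_nonempty G.
by apply/card_gt0P; exists (inr (e0, v)).
Qed.

Definition descartes : sgraph := SGraph dedge_sym dedge_irrefl dvertex_nonempty.

Definition copy (e : block H) (v : G) : descartes := inr (e, v).
Definition anchor (u : point H) : descartes := inl u.

Lemma copy_inj e : injective (copy e).
Proof. by move=> u v []. Qed.

Lemma copy_edge e u v : edge (copy e u) (copy e v) -> edge u v.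
Proof. by case/andP. Qed.

(** The neighbours of an anchor lie in different copies. *)
Lemma descartes_triangle_free : triangle_free G -> triangle_free descartes.
Proof.
move=> tG.
have apex u p q : foot p = u -> foot q = u -> ~~ ((p.1 == q.1) && edge p.2 q.2).
  move=> pu qu; apply/negP => /andP[/eqP e12].
  by rewrite (foot_inj (etrans pu (esym qu)) e12) edge_irrefl.
case=> -[u|p] [[v|q] [[z|r] []]] //=.
- by move=> /eqP qu + /eqP ru; apply/negP; apply: apex qu ru.
- by move=> /eqP pv /eqP rv; apply/negP; apply: apex pv rv.
- by move=> + /eqP qz /eqP pz; apply/negP; apply: apex pz qz.
- move=> /andP[/eqP _ pq] /andP[/eqP _ qr] /andP[_ pr].
  by apply: tG; exists p.2, q.2, r.2.
Qed.

Lemma descartes_no_coloring k :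
  monochromatic k H -> no_coloring G k -> no_coloring descartes k.+1.
Proof.
move=> mH nG [c cP]; have [e [kappa ek]] := mH (fun u => c (anchor u)).
have ne v : kappa != c (copy e v).
  rewrite -(ek v); apply: cP; exact: eqxx.
apply: nG.
pose d v : 'I_k := sval (unlift_some (ne v)).
have dP v : c (copy e v) = lift kappa (d v).
  by rewrite /d; case: (unlift_some (ne v)) => ? /= ->.
exists d => x y xy; have := cP (copy e x) (copy e y).
rewrite /= eqxx /= => /(_ xy); rewrite !dP; apply: contra_neq => -> //.
Qed.

Section Step.
Variables (M F : nat).
Hypotheses (sH : sparse_cuts H M) (cG : cut_or_small G M F) (F_gt0 : 0 < F).
Implicit Types (R : {set descartes}) (w : descartes -> nat).

Lemma cut_or_small_copy R w e : (forall x, 0 < w x) ->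
  R \subset codom (copy e) ->
  cheap_cut M R w \/ exists2 Z : {set descartes}, #|Z| <= F & halved R w Z.
Proof.
move=> w0 Re.
have -> : R = copy e @: (copy e @^-1: R).
  apply/setP => x; apply/idP/imsetP => [xR|[v]]; last by rewrite inE => ? ->.
  have /codomP[v xv] := subsetP Re x xR.
  by exists v; rewrite // inE -xv.
have [cut|[Z leZ hZ]] := cG (copy e @^-1: R) (fun v => w0 (copy e v)).
  by left; apply: cheap_cut_embed cut; [exact: copy_inj | exact: copy_edge].
right; exists (copy e @: Z); first by rewrite card_imset //; exact: copy_inj.
by apply: halved_embed hZ; [exact: copy_inj | exact: copy_edge].
Qed.

(** The edges between anchors and copies inside R, seen as incidences. *)
Definition rungs R : {set block H * G} :=
  [set p | (inr p \in R) && (anchor (foot p) \in R)].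

(** All copies stay whole, and only anchors are cut; distinct incidences give
    distinct vertices, so each bank is at least as heavy as its half. *)
Lemma cheap_cut_rungs R w : (forall x, 0 < w x) ->
  (forall u, anchor u \in R -> 0 < deg (rungs R) (inl u)) ->
  cuttable M (rungs R) -> cheap_cut M R w.
Proof.
move=> w0 dR [side sP].
pose up b := @foot _ H @: half (rungs R) side b.
pose h (x : descartes) : option bool :=
  match x with
  | inl u => if u \in border (rungs R) side then None else Some (u \in up true)
  | inr p => Some (side p.1)
  end.
have rung p u : inr p \in R -> anchor u \in R -> foot p = u -> p \in rungs R.
  by move=> pR uR pu; rewrite inE pR pu.
have mixed p u b c : inr p \in R -> anchor u \in R -> foot p = u ->
    Some (side p.1) = Some b -> h (anchor u) = Some c -> b = c.
  move=> pR uR pu [<-] /=; case: ifPn => // nb [<-].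
  have pX := rung p u pR uR pu.
  case sp : (side p.1); first by apply/esym/imsetP; exists p; rewrite // inE pX sp.
  apply/esym/negbTE; apply: contraNN nb => uT; rewrite inE -/(up true) uT.
  by apply/imsetP; exists p; rewrite // inE pX sp.
exists h.
  case=> [u|p] [v|q] b c xR yR //=.
  - by move=> /eqP qu hu hq; apply/esym; apply: mixed qu hq hu.
  - by move=> /eqP pv; apply: mixed.
  - by case/andP=> /eqP -> _ [<-] [].
have gapE : #|gap R h| <= #|border (rungs R) side|.
  rewrite -(card_imset (f := anchor) (border _ _)); last by move=> ? ? [].
  apply/subset_leq_card/subsetP => -[u|p]; rewrite inE => /andP[_] //=.
  by case: ifP => // ub _; apply: (imset_f anchor).
move=> b; have [n0 le] := sP b.
have sub : [set (inr p : descartes) | p in half (rungs R) side b] \subset bank R h b.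
  apply/subsetP => _ /imsetP[p + ->]; rewrite !inE => /andP[/andP[-> _] /eqP ps] /=.
  by rewrite ps.
split.
  apply: contraNneq n0 => e; rewrite e subset0 imset_eq0 in sub.
  exact: sub.
apply: leq_trans (leq_mul (leqnn M) gapE) (leq_trans le _).
rewrite -(card_imset (f := (fun p => inr p : descartes))); last by move=> ? ? [].
by apply: leq_trans (subset_leq_card sub) _; apply: card_le_weight.
Qed.

(** Vertices with at most one neighbour in R are folded away.  When none is left
    and the rungs have no cheap cut, R lies in one copy, or some copy has a
    single rung.  In the latter case that copy and the rest of R hang on one
    another by an edge, and the lighter of the two is folded onto the other. *)
Lemma cut_or_small_descartes : cut_or_small descartes M F.
Proof.
move=> R; have [n] := ubnP #|R|; elim: n R => // n IH R ltn w w0.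
have [->|R0] := eqVneq R set0.
  right; exists set0; first by rewrite cards0.
  exists (fun=> 0) => // i; rewrite /weight big_pred0 // => x.
  by rewrite !inE.
have [/existsP[x /andP[xR big]]|light] :=
    boolP [exists x, (x \in R) && (weight R w <= 2 * w x)].
  right; exists [set x]; first by rewrite cards1.
  exists (fun=> 0) => // i; apply: leq_trans (_ : _ <= 2 * weight (R :\ x) w) _.
    rewrite leq_mul2l; apply/orP; right; apply/weightS/subsetP => z.
    by rewrite inE => /andP[].
  have := @weightD _ R [set x] w; rewrite sub1set weight1 => /(_ xR); lia.
have {}light x : x \in R -> 2 * w x <= weight R w.
  by move=> xR; move/existsPn/(_ x): light; rewrite xR /= -ltnNge => /ltnW.
(* Fold T and use the induction on the size of R. *)
have fold_step (T : {set descartes}) y : T \subset R -> T != set0 -> y \in R :\: T ->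
    (forall x z, x \in T -> z \in R :\: T -> edge x z -> z = y) ->
    2 * weight T w <= weight R w ->
    cheap_cut M R w \/ exists2 Z : {set descartes}, #|Z| <= F & halved R w Z.
  move=> TR T0 yR only leT.
  have [||cut|[Z leZ hZ]] := IH (R :\: T) _ (fold_weight T y w).
  - rewrite ltnS in ltn; apply: leq_trans _ ltn; rewrite -(cardsID T R).
    by rewrite (setIidPr TR) -addn1 addnC leq_add2r card_gt0.
  - by move=> x; rewrite /fold_weight; have := w0 x; lia.
  - by left; apply: cheap_cut_unfold cut.
  - by right; exists Z => //; apply: halved_unfold hZ.
pose nbr x := [set z in R | edge x z].
have [/existsP[x /andP[xR leaf]]|full] :=
    boolP [exists x, (x \in R) && (#|nbr x| <= 1)].
  have [n0|/set0Pn[y yN]] := eqVneq (nbr x) set0.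
    have [Rx|/subsetPn[z zR]] := boolP (R \subset [set x]).
      have RE : R = [set x] by apply/eqP; rewrite eqEsubset Rx sub1set.
      by have := light x xR; rewrite RE weight1; have := w0 x; lia.
    rewrite inE => zx; left; exists (fun z => Some (z == x)).
      have iso u : u \in R -> ~~ edge x u.
        by move=> uR; apply/negP => xu; move/setP/(_ u): n0; rewrite !inE uR xu.
      move=> u v b c uR vR uv [<-] [<-]; case: eqP => [ux|_].
        by have := iso v vR; rewrite -ux uv.
      by case: eqP => // vx; have := iso u uR; rewrite -vx edge_sym uv.
    have -> : gap R (fun z => Some (z == x)) = set0.
      by apply/setP => u; rewrite !inE andbF.
    move=> b; rewrite cards0 muln0; split=> //; apply/set0Pn.
    by case: b; [exists x | exists z]; rewrite !inE ?xR ?zR ?eqxx ?(negbTE zx).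
  have := yN; rewrite inE => /andP[yR xy].
  apply: (fold_step [set x] y); rewrite ?sub1set ?weight1 ?light //.
  - by apply/set0Pn; exists x; rewrite inE.
  - by rewrite !inE yR andbT; apply: contraTneq xy => ->; rewrite edge_irrefl.
  - move=> _ z /set1P-> /setDP[zR _] xz.
    by apply: (card_le1_eqP leaf); rewrite // inE zR.
have {}full x : x \in R -> 1 < #|nbr x|.
  by move=> xR; move/existsPn/(_ x): full; rewrite xR /= -ltnNge.
have degE u : anchor u \in R -> deg (rungs R) (inl u) = #|nbr (anchor u)|.
  move=> uR; rewrite /deg -(card_imset (f := (fun p => inr p : descartes)));
    last by move=> ? ? [].
  apply: eq_card => -[v|p].
    by rewrite !inE andbF; apply/imsetP => -[].
  rewrite !inE; apply/imsetP/andP.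
    by case=> q; rewrite !inE => /andP[/andP[qR _] qu] [->].
  case=> pR /eqP pu; exists p => //.
  by rewrite !inE pR /= pu uR eqxx.
have [cut|ncut] := EM (cuttable M (rungs R)).
  left; apply: cheap_cut_rungs cut => // u uR.
  by rewrite degE // ltnW // full.
have copyP e x : (x \in codom (copy e)) = (if x is inr p then p.1 == e else false).
  apply/codomP/idP => [[v ->]|]; first exact: eqxx.
  by case: x => // -[e' v] /= /eqP ->; exists v.
have across e x z : x \in codom (copy e) -> z \notin codom (copy e) -> edge x z ->
    exists2 p, x = inr p /\ p.1 = e & z = anchor (foot p).
  rewrite !copyP; case: x => // p pe; case: z => [u|q] /=.
    by move=> _ /eqP <-; exists p; rewrite // (eqP pe).
  by move=> qe /andP[/eqP pq _]; rewrite -pq pe in qe.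
have [Y0|Y0] := eqVneq (rungs R) set0.
  have no_anchor u : anchor u \notin R.
    apply/negP => uR; have := full _ uR; rewrite -degE // Y0.
    by rewrite /deg eq_card0 // => p; rewrite !inE.
  have /set0Pn[[u|p] xR] := R0; first by move: (no_anchor u); rewrite xR.
  have [sub|/subsetPn[z zR zp]] := boolP (R \subset codom (copy p.1)).
    exact: cut_or_small_copy sub.
  left; exists (fun x => Some (x \in codom (copy p.1))).
    move=> x y b c xR' yR xy [<-] [<-]; apply/idP/idP.
      move=> xp; apply/negPn/negP => yp; have [q _ yq] := across _ _ _ xp yp xy.
      by move: (no_anchor (foot q)); rewrite -yq yR.
    move=> yp; apply/negPn/negP => xp; rewrite edge_sym in xy.
    have [q _ xq] := across _ _ _ yp xp xy.
    by move: (no_anchor (foot q)); rewrite -xq xR'.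
  have -> : gap R (fun x => Some (x \in codom (copy p.1))) = set0.
    by apply/setP => u; rewrite !inE andbF.
  move=> b; rewrite cards0 muln0; split=> //; apply/set0Pn.
  case: b; [exists (inr p) | exists z]; rewrite inE ?xR ?zR ?(negbTE zp) //.
  by rewrite copyP eqxx.
have [m m1] : exists m, deg (rungs R) m = 1.
  apply: contra_notP ncut => none; apply: sH => // m.
  by apply/eqP => m1; apply: none; exists m.
have [y yY ym] : exists2 y, y \in rungs R & meets y m by apply: deg_gt0P; rewrite m1.
have := yY; rewrite inE => /andP[yR fyR].
case: m m1 ym => [u|e] m1 ym.
  have uR : anchor u \in R by rewrite -(eqP ym).
  by have := full _ uR; rewrite -degE // m1.
have ye : y.1 = e by apply/eqP.
pose T := R :&: [set x in codom (copy e)].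
have only p : inr p \in R -> anchor (foot p) \in R -> p.1 = e -> p = y.
  move=> pR fR pe; apply: (deg1_unique m1 yY ym); first by rewrite inE pR.
  by rewrite /= pe.
have TR : T \subset R by exact: subsetIl.
have yT : inr y \in T by rewrite !inE yR copyP ye eqxx.
have fyT : anchor (foot y) \in R :\: T by rewrite !inE fyR copyP.
have out x z : x \in T -> z \in R :\: T -> edge x z -> x = inr y /\ z = anchor (foot y).
  rewrite !inE => /andP[xR xe] /andP[+ zR]; rewrite zR /= => ze xz.
  have [p [xp pe] zp] := across _ _ _ xe ze xz.
  by rewrite xp zp (only p) // -?xp -?zp.
have [small|large] := leqP (2 * weight T w) (weight R w).
  apply: (fold_step T (anchor (foot y))) => //.
    by apply/set0Pn; exists (inr y).
  by move=> x z xT zT xz; have [_ ->] := out x z xT zT xz.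
have DD : R :\: (R :\: T) = T by rewrite setDDr setDv set0U; apply/setIidPr.
have yDD : inr y \in R :\: (R :\: T) by rewrite DD.
have leD : 2 * weight (R :\: T) w <= weight R w.
  by have := weightD w TR; lia.
have onlyD x z : x \in R :\: T -> z \in R :\: (R :\: T) -> edge x z -> z = inr y.
  by rewrite DD => xT zT xz; rewrite edge_sym in xz; have [] := out z x zT xT xz.
have [||cut|[Z leZ hZ]] := @cut_or_small_copy T (fold_weight (R :\: T) (inr y) w) e.
- by move=> x; rewrite /fold_weight; have := w0 x; lia.
- by apply/subsetP => x; rewrite !inE => /andP[].
- left; apply: (cheap_cut_unfold (subsetDl R T) onlyD).
  by rewrite DD.
- right; exists Z => //; apply: (halved_unfold (subsetDl R T) yDD onlyD leD).
  by rewrite DD.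
Qed.

End Step.
End Descartes.

(** * The sequence of graphs and its separators *)

Lemma next_graph (G : sgraph) (k : nat) : no_coloring G k -> triangle_free G ->
  exists G' : sgraph, [/\ no_coloring G' k.+1, triangle_free G' &
    forall t F, t <= k -> 0 < F -> cut_or_small G (2 ^ t) F ->
      cut_or_small G' (2 ^ t) F].
Proof.
move=> nG tG; have [H mH sH] := sparse_monochromatic G k k.
have [e0 _] := mH (fun=> ord0).
exists (descartes e0); split.
- exact: descartes_no_coloring.
- exact: descartes_triangle_free.
- move=> t F tk F0 cG; apply: cut_or_small_descartes => //.
  by apply: sparse_cuts_weaken sH; rewrite leq_exp2l.
Qed.

Lemma unit_graph_irrefl : irreflexive (fun _ _ : unit => false).
Proof. by []. Qed.

Lemma unit_graph_nonempty : 0 < #|{: unit}|.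
Proof. by rewrite card_unit. Qed.

Definition unit_graph : sgraph :=
  @SGraph unit (fun _ _ => false) (fun _ _ => erefl) unit_graph_irrefl unit_graph_nonempty.

Lemma graph_tower : exists T : nat -> sgraph,
  [/\ forall k, no_coloring (T k) k, forall k, triangle_free (T k) &
    forall k t F, t <= k -> 0 < F -> cut_or_small (T k) (2 ^ t) F ->
      cut_or_small (T k.+1) (2 ^ t) F].
Proof.
pose ok (x : sgraph * nat) := no_coloring x.1 x.2 /\ triangle_free x.1.
have [|next nextP] := choice (P := fun x G' => ok x ->
    ok (G', x.2.+1) /\ forall t F, t <= x.2 -> 0 < F ->
      cut_or_small x.1 (2 ^ t) F -> cut_or_small G' (2 ^ t) F).
  move=> [G k]; have [[nG tG]|nok] := EM (ok (G, k)); last by exists G.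
  by have [G' [? ? ?]] := next_graph nG tG; exists G'.
pose T := fix T k := if k is k'.+1 then next (T k', k') else unit_graph.
have okT k : ok (T k, k).
  elim: k => [|k IH]; last by have [] := nextP _ IH.
  by split=> [[c _]|[x [y [z []]]]] //; case: (c tt).
by exists T; split=> [k|k|k]; [case: (okT k)|case: (okT k)|have [] := nextP _ (okT k)].
Qed.

(** Up to index t the whole vertex set serves as a halving set; afterwards the
    construction preserves the bound. *)
Lemma tower_cut_or_small (T : nat -> sgraph) :
  (forall k t F, t <= k -> 0 < F -> cut_or_small (T k) (2 ^ t) F ->
      cut_or_small (T k.+1) (2 ^ t) F) ->
  forall t, exists F, forall k, cut_or_small (T k) (2 ^ t) F.
Proof.
move=> step t; exists (\sum_(k < t.+1) #|T k|) => k.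
set F := \sum_(_ < _) _.
have small j : j <= t -> #|T j| <= F.
  by move=> jt; rewrite /F (bigD1 (Ordinal (jt : j < t.+1))) //= leq_addr.
have F0 : 0 < F by apply: leq_trans (small 0 _); rewrite ?vertex_nonempty.
have early j : j <= t -> cut_or_small (T j) (2 ^ t) F.
  move=> jt R w _; right; exists R.
    by apply: leq_trans (small j jt); apply: max_card.
  exists (fun=> 0) => // i; rewrite /weight big_pred0 // => x.
  by rewrite !inE andNb.
elim: k => [|k IH]; first exact: early.
by have [kt|kt] := leqP t k; [apply: step | apply: early].
Qed.

(** Put the lighter bank aside and go on with the other one.  Every cut costs at
    most 1/M of the bank put aside, and these banks are disjoint, which pays for
    the term #|R|; the final halving set costs F. *)
Lemma separator_of_cuts (G : sgraph) M F : cut_or_small G M F ->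
  forall (R : {set G}) n, #|R| <= n ->
  exists (S : {set G}) (l : G -> nat),
    [/\ M * #|S| <= #|R| + M * F,
        forall x y, x \in R :\: S -> y \in R :\: S -> edge x y -> l x = l y
      & forall i, 2 * #|[set x in R :\: S | l x == i]| <= n].
Proof.
move=> cG R; have [m] := ubnP #|R|; elim: m R => // m IH R ltm n Rn.
have wE (A : {set G}) : weight A (fun=> 1) = #|A| by rewrite -sum1_card.
have [[h hs hP]|[Z leZ [l le lP]]] := cG R (fun=> 1) (fun=> isT); last first.
  exists Z, l; split=> //.
    by rewrite addnC (leq_trans _ (leq_addr _ _)) // leq_mul2l leZ orbT.
  by move=> i; have := lP i; rewrite !wE => /leq_trans; apply.
have [b bP] : exists b, #|bank R h (~~ b)| <= #|bank R h b|.
  by case/orP: (leq_total #|bank R h false| #|bank R h true|); [exists true|exists false].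
have disj b1 b2 x : x \in bank R h b1 -> x \in bank R h b2 -> b1 = b2.
  by rewrite !inE => /andP[_ /eqP->] /andP[_ /eqP[]].
have sum : #|bank R h b| + #|bank R h (~~ b)| <= #|R|.
  rewrite -cardsUI (_ : _ :&: _ = set0) ?cards0 ?addn0.
    by apply/subset_leq_card/subsetP => x; rewrite !inE; case/orP => /andP[].
  apply/setP => x; rewrite [in RHS]inE; apply/negP => /setIP[x1 x2].
  by have := disj _ _ _ x1 x2; case: (b).
have [n0 leM] := hP (~~ b).
have pos : 0 < #|bank R h (~~ b)| by rewrite card_gt0.
have [||S [l [leS le lP]]] := IH (bank R h b) _ n; [lia | lia |].
exists (S :|: gap R h), (fun x => if x \in bank R h b then (l x).+1 else 0).
split.
- have : #|S :|: gap R h| <= #|S| + #|gap R h|.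
    by rewrite -cardsUI leq_addr.
  rewrite wE in leM.
  nia.
- have side x : x \in R :\: (S :|: gap R h) ->
      (x \in bank R h b) || (x \in bank R h (~~ b)).
    rewrite !inE negb_or => /andP[/andP[_ hx] xR]; move: hx; rewrite xR /=.
    by case: (h x) => [[]|] //; case: (b).
  move=> x y xR yR xy.
  have xx := side x xR; have yy := side y yR.
  case: ifP xx => xb /= xx; case: ifP yy => yb /= yy //.
  + congr _.+1; apply: le => //.
      by move: xR xb; rewrite !inE negb_or => /andP[/andP[-> _] _] ->.
    by move: yR yb; rewrite !inE negb_or => /andP[/andP[-> _] _] ->.
  + move: xb yy; rewrite !inE => /andP[xR' /eqP hx] /andP[yR' /eqP hy].
    by have := hs x y _ _ xR' yR' xy hx hy; case: (b).
  + move: yb xx; rewrite !inE => /andP[yR' /eqP hy] /andP[xR' /eqP hx].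
    by have := hs x y _ _ xR' yR' xy hx hy; case: (b).
- case=> [|i].
    apply: (@leq_trans (2 * #|bank R h (~~ b)|)); last by lia.
    rewrite leq_mul2l /=; apply/subset_leq_card/subsetP => x.
    rewrite !inE negb_or => /andP[/andP[/andP[_ hx] xR]]; move: hx; rewrite xR /=.
    by case: (h x) => [c|] //= _; case: (b); case: c.
  apply: leq_trans (lP i); rewrite leq_mul2l /=; apply/subset_leq_card/subsetP => x.
  rewrite !inE negb_or => /andP[/andP[/andP[-> _] ->]] /=.
  by case: ifP.
Qed.

Lemma connect_invariant (T : finType) (L : eqType) (e : rel T) (l : T -> L) x y :
  (forall a b, e a b -> l a = l b) -> connect e x y -> l x = l y.
Proof.
move=> el /connectP[p + ->]; elim: p x => //= z p IH x /andP[/el -> /IH].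
by [].
Qed.

Lemma subgraph_separator (G H : sgraph) M F : cut_or_small G M F -> subgraph H G ->
  exists2 S : {set H}, balanced_separator S & M * #|S| <= #|H| + M * F.
Proof.
move=> cG [h [h_inj h_edge]].
have [|S [l [leS le lP]]] := separator_of_cuts cG (R := h @: [set: H]) (n := #|H|).
  by rewrite card_imset ?cardsT.
have inR x : h x \in h @: [set: H] by rewrite imset_f.
exists (h @^-1: S); last first.
  rewrite card_imset // cardsT in leS; apply: leq_trans leS.
  rewrite leq_mul2l; apply/orP; right.
  rewrite -(card_imset _ h_inj); apply/subset_leq_card/subsetP.
  by move=> _ /imsetP[x + ->]; rewrite inE.
move=> K /imsetP[x xS ->]; set C := [set y in _ | _].
have : 2 * #|C| <= #|H|; last by lia.
apply: leq_trans (lP (l (h x))); rewrite leq_mul2l /= -(card_imset _ h_inj).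
apply/subset_leq_card/subsetP => _ /imsetP[y + ->].
rewrite !inE => /andP[yS xy]; rewrite yS inR /=; apply/eqP/esym.
apply: (connect_invariant (l := l \o h) _ xy) => a b /and3P[].
rewrite !inE => aS bS ab; apply: le; rewrite ?inE ?aS ?bS ?inR //.
exact: h_edge.
Qed.

Lemma no_coloring_chromatic (G : sgraph) k : no_coloring G k -> k < chromatic_number G.
Proof.
rewrite /chromatic_number => nG; case: ex_minnP => m /existsP[c cP] _.
rewrite ltnNge; apply/negP => mk; apply: nG.
exists (fun x => widen_ord mk (c x)) => x y xy.
have /forallP/(_ y)/implyP/(_ xy) := forallP cP x.
by apply: contra_neq => /(congr1 val) /= /val_inj.
Qed.

Lemma full_separator (G : sgraph) : balanced_separator [set: G].
Proof.
by move=> K /imsetP[x]; rewrite setCT inE.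
Qed.

Import Order.TTheory GRing.Theory Num.Theory.
Import numFieldNormedType.Exports.

(** The function f is the least size that suffices for all graphs of the class on
    n vertices; the witnesses for different t need not be related. *)
Lemma sublinear_of_integer_bounds (R : realType) (C : graph_class) :
  (forall t, exists F, forall G, C G -> exists2 S : {set G},
      balanced_separator S & 2 ^ t * #|S| <= #|G| + 2 ^ t * F) ->
  sublinear_separators R C.
Proof.
move=> bound.
pose ok n m := `[< forall G, C G -> #|G| = n ->
  exists2 S : {set G}, balanced_separator S & #|S| <= m >].
have exok n : exists m, ok n m.
  exists n; apply/asboolP => G _ <-; exists [set: G]; first exact: full_separator.
  exact: max_card.
pose s n := ex_minn (exok n).
have sP n : ok n (s n) by rewrite /s; case: ex_minnP.
have s_le t : exists F, forall n, 2 ^ t * s n <= n + 2 ^ t * F.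
  have [F FP] := bound t; exists F => n; rewrite mulnC -leq_divRL ?expn_gt0 //.
  rewrite /s; case: ex_minnP => m _; apply; apply/asboolP => G CG Gn.
  have [S bS leS] := FP G CG; exists S => //.
  by rewrite leq_divRL ?expn_gt0 // mulnC -Gn.
pose f (n : nat) : R := ((s n)%:R)%R.
exists f; split; last first.
  move=> G CG; have /asboolP/(_ G CG erefl)[S bS leS] := sP #|G|.
  by exists S; rewrite ler_nat.
apply/eqoP => eps eps0.
(* The factor 2 leaves room for the additive term F, which is at most n / 2^t
   once n is large. *)
pose t := Num.bound (2 / eps)%R.
have [F sF] := s_le t.
near=> n.
have nF : 2 ^ t * F <= n by near: n; exact: nbhs_infty_ge.
have sn : 2 ^ t * s n <= 2 * n by have := sF n; lia.
rewrite !ger0_norm ?ler0n //.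
have t0 : (0 < (2 ^ t)%:R :> R)%R by rewrite ltr0n expn_gt0.
have te : (2 <= eps * (2 ^ t)%:R :> R)%R.
  rewrite mulrC -ler_pdivrMr //; apply: (@le_trans _ _ t%:R%R).
    by apply/ltW/archi_boundP/divr_ge0; rewrite ?ltW.
  by rewrite ler_nat ltnW // ltn_expl.
rewrite -(ler_pM2l t0) -natrM; apply: (@le_trans _ _ (2 * n)%:R%R).
  by rewrite ler_nat.
by rewrite natrM mulrA ler_wpM2r ?ler0n // mulrC.
Unshelve. all: by end_near. Qed.

Theorem theorem8p1 (R : realType) :
  exists C : graph_class,
    [/\ monotone_class C,
        forall G : sgraph, C G -> triangle_free G,
        unbounded_chromatic_number C
      & sublinear_separators R C].
Proof.
have [T [nT tT stepT]] := graph_tower.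
exists (fun H => exists k, subgraph H (T k)); split.
- move=> G H [k [g [gi ge]]] [h [hi he]]; exists k, (g \o h).
  by split=> [|x y /he/ge//]; apply: inj_comp.
- move=> G [k [h [_ he]]] [x [y [z [/he xy /he yz /he xz]]]].
  by apply: (tT k); exists (h x), (h y), (h z).
- move=> k; exists (T k); split; last exact: no_coloring_chromatic.
  by exists k, id; split.
- apply: sublinear_of_integer_bounds => t.
  have [F FP] := tower_cut_or_small stepT t.
  by exists F => G [k /(subgraph_separator (FP k))].
Qed.
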